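(* Every weakly nil clean ring is a corner of a clean ring; that is, for every weakly nil clean ring $R$ there exist a clean ring $S$ and an idempotent $e\in S$ such that $R\cong eSe$ as rings.
   Context: Rings are associative with unity, not necessarily commutative. A ring $R$ is weakly nil clean if for every $a\in R$ there exist an idempotent $e\in R$ and a nilpotent $q\in R$ such that $a-e-q\in eRa$. A ring is clean if every element can be written as a sum of an idempotent and an invertible element. For an idempotent $e$ of a ring $S$, the corner ring $eSe$ is a ring with identity $e$. *)

(* Defs.v *)
From HB Require Import structures.
From mathcomp Require Import all_boot all_algebra.
Set Implicit Arguments.
Unset Strict Implicit.
Unset Printing Implicit Defensive.
Import GRing.Theory.
Local Open Scope ring_scope.

(* Rings are pzRingType: associative and unital, with 1 = 0 allowed. In
   particular the corner at the idempotent 0, the zero ring, is a ring. *)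

Section RingElements.
Variable R : pzRingType.
Implicit Types a e q u : R.

Definition idempotent_elt e : Prop := e * e = e.

Definition nilpotent_elt q : Prop := exists n : nat, q ^+ n = 0.

Definition invertible_elt u : Prop := exists v, u * v = 1 /\ v * u = 1.

End RingElements.

Definition weakly_nil_clean (R : pzRingType) : Prop :=
  forall a : R, exists e q : R,
    [/\ idempotent_elt e, nilpotent_elt q
      & exists r : R, a - e - q = e * r * a].

Definition clean (R : pzRingType) : Prop :=
  forall a : R, exists e u : R,
    [/\ idempotent_elt e, invertible_elt u & a = e + u].

Section CornerSet.
Variables (S : pzRingType) (e : S).

(* Membership in eSe = {e s e | s in S}, put in boolean form by means of
   e e = e; see in_cornerP. *)
Definition in_corner : {pred S} := [pred x | e * x * e == x].

Lemma in_cornerP (idem_e : idempotent_elt e) (x : S) :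
  reflect (exists s, x = e * s * e) (x \in in_corner).
Proof.
apply: (iffP eqP) => [<-|[s ->]]; first by exists x.
by rewrite !mulrA idem_e -mulrA idem_e.
Qed.

Fact in_corner_zmod_closed : zmod_closed in_corner.
Proof.
split=> [|x y /eqP ex /eqP ey]; first by rewrite inE mulr0 mul0r.
by rewrite inE mulrBr mulrBl ex ey.
Qed.

(* The proof idem_e is a parameter of the type because the ring structure
   declared below, whose identity is e, needs it. *)
Record corner (idem_e : idempotent_elt e) := Corner {
  corner_val : S;
  corner_valP : corner_val \in in_corner
}.

End CornerSet.

Section CornerRing.
Variables (S : pzRingType) (e : S) (idem_e : idempotent_elt e).

HB.instance Definition _ := [isSub for @corner_val S e idem_e].
HB.instance Definition _ := [Choice of corner idem_e by <:].
HB.instance Definition _ := GRing.SubChoice_isSubZmodule.Build S (in_corner e)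
  (corner idem_e) (in_corner_zmod_closed e).

Implicit Types x y z : corner idem_e.

Fact corner_one_subproof : e \in in_corner e.
Proof. by rewrite inE !idem_e. Qed.

Fact corner_mul_subproof x y : corner_val x * corner_val y \in in_corner e.
Proof.
case: x y => [x /= /eqP ex] [y /= /eqP ey].
apply/(in_cornerP idem_e); exists (x * e * e * y).
by rewrite -{1}ex -{1}ey !mulrA.
Qed.

Definition corner_one : corner idem_e := Corner idem_e corner_one_subproof.

Definition corner_mul x y : corner idem_e :=
  Corner idem_e (corner_mul_subproof x y).

Fact corner_mulA : associative corner_mul.
Proof. by move=> x y z; apply/val_inj; rewrite /= mulrA. Qed.

Fact corner_mul1r : left_id corner_one corner_mul.
Proof.
by move=> [x ex]; apply/val_inj => /=; rewrite -(eqP ex) !mulrA idem_e.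
Qed.

Fact corner_mulr1 : right_id corner_one corner_mul.
Proof.
by move=> [x ex]; apply/val_inj => /=; rewrite -(eqP ex) -!mulrA idem_e.
Qed.

Fact corner_mulDl : left_distributive corner_mul +%R.
Proof. by move=> x y z; apply/val_inj; rewrite /= mulrDl. Qed.

Fact corner_mulDr : right_distributive corner_mul +%R.
Proof. by move=> x y z; apply/val_inj; rewrite /= mulrDr. Qed.

HB.instance Definition _ := GRing.Zmodule_isPzRing.Build (corner idem_e)
  corner_mulA corner_mul1r corner_mulr1 corner_mulDl corner_mulDr.

End CornerRing.

(* Main.v *)
(** Weak nil cleanness of [- b] yields [p] and an idempotent [f] with [f p = f]
    and [p b - f] invertible; by Schur complements this property passes from R to
    all matrix rings over R. It makes the block matrix diag(b, 0) clean: with the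
    invertible matrix s = [[p, p - 1], [1, 1]], the difference
    s diag(b, 0) - diag(f, 1) s equals [[p b - f, 0], [b - 1, -1]].

    The clean ring S consists of the infinite matrices diag(A, c, c, ...) with A a
    finite matrix over R and c in the center of R; its corner at the first diagonal
    matrix unit is R. Since R is weakly nil clean, its center is strongly
    pi-regular, so central idempotents split R into three parts on which c is
    nilpotent, 1 - c is nilpotent, or both c and 1 - c are invertible. On the first
    part diag(b, c) is clean by the above, on the second one passes to
    diag(1 - b, 1 - c), and on the third the idempotent [[1 - c, 1 - c], [c, c]]
    works for every b. *)
From HB Require Import structures.
Require Import Defs.
From mathcomp Require Import all_boot all_algebra.
From mathcomp Require Import boolp functions.
Set Implicit Arguments.
Unset Strict Implicit.
Unset Printing Implicit Defensive.
Import GRing.Theory.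
Local Open Scope ring_scope.

(** * Clean elements and gluing along central idempotents *)

Section CleanElements.
Variable R : pzRingType.
Implicit Types a b c e f p q s u v w x z : R.

Definition central c : Prop := forall x, GRing.comm c x.

Definition clean_elt a : Prop :=
  exists e u, [/\ idempotent_elt e, invertible_elt u & a = e + u].

Definition weakly_clean_elt b : Prop :=
  exists p f, [/\ idempotent_elt f, f * p = f & invertible_elt (p * b - f)].

Lemma invertible_eltM u v :
  invertible_elt u -> invertible_elt v -> invertible_elt (u * v).
Proof.
move=> [u' [uu' u'u]] [v' [vv' v'v]]; exists (v' * u'); split.
  by rewrite mulrA -(mulrA u) vv' mulr1.
by rewrite mulrA -(mulrA v') u'u mulr1.
Qed.

Lemma invertible_eltN u : invertible_elt u -> invertible_elt (- u).
Proof. by move=> [v [uv vu]]; exists (- v); rewrite !mulrNN. Qed.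

Lemma invertible_elt_sub1 q : nilpotent_elt q -> invertible_elt (1 - q).
Proof.
move=> [n qn0]; exists (\sum_(i < n) q ^+ i).
have inv_l : (1 - q) * (\sum_(i < n) q ^+ i) = 1.
  by rewrite -opprB mulNr -subrX1 qn0 sub0r opprK.
split=> //; rewrite -[RHS]inv_l; apply/esym/commr_sum => i _.
apply/commr_sym/commrB; first exact: commr1.
exact/commr_sym/commrX.
Qed.

Lemma central_inv u v : central u -> u * v = 1 -> v * u = 1 -> central v.
Proof.
move=> cu uv vu x.
by rewrite /GRing.comm -[x in LHS]mulr1 -uv (mulrA x) -cu !mulrA vu mul1r.
Qed.

Lemma nilpotent_eltM_central c x :
  central c -> nilpotent_elt c -> nilpotent_elt (c * x).
Proof.
by move=> cc [n cn0]; exists n; rewrite (exprMn_comm _ (cc x)) cn0 mul0r.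
Qed.

Lemma clean_elt_compl a : clean_elt (1 - a) -> clean_elt a.
Proof.
move=> [e [u [ee uinv a_eq]]]; exists (1 - e), (- u); split.
- by rewrite /idempotent_elt mulrBl mul1r mulrBr mulr1 ee subrr subr0.
- exact: invertible_eltN.
- by rewrite -addrA -opprD -a_eq opprB addrC subrK.
Qed.

Lemma mulr_compl_idem z : idempotent_elt z -> z * (1 - z) = 0.
Proof. by move=> zz; rewrite mulrBr mulr1 zz subrr. Qed.

Lemma idem_compl z : idempotent_elt z -> idempotent_elt (1 - z).
Proof.
by move=> zz; rewrite /idempotent_elt mulrBl mul1r mulr_compl_idem ?subr0.
Qed.

Lemma central_compl z : central z -> central (1 - z).
Proof. by move=> cz x; apply/commr_sym/commrB; [exact: commr1|exact/commr_sym/cz]. Qed.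

(* Multiplication in the product decomposition zR x (1 - z)R. *)
Lemma mulr_glue z x1 x2 y1 y2 : central z -> idempotent_elt z ->
  (z * x1 + (1 - z) * x2) * (z * y1 + (1 - z) * y2) =
  z * (x1 * y1) + (1 - z) * (x2 * y2).
Proof.
move=> cz zz; have czc := central_compl cz.
have zzc := mulr_compl_idem zz.
have zcz : (1 - z) * z = 0 by rewrite -cz.
have zczc : (1 - z) * (1 - z) = 1 - z by rewrite mulrBl mul1r zzc subr0.
have sw w w' x y : central w' -> w * x * (w' * y) = w * w' * (x * y).
  by move=> cw; rewrite mulrA -(mulrA w) -cw !mulrA.
rewrite mulrDl !mulrDr (sw z z) // (sw z (1 - z)) // (sw (1 - z) z) //.
by rewrite (sw (1 - z) (1 - z)) // zz zzc zcz zczc !mul0r addr0 add0r.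
Qed.

Lemma glue1 z : z * 1 + (1 - z) * 1 = 1.
Proof. by rewrite !mulr1 addrC subrK. Qed.

Lemma clean_elt_glue z a b : central z -> idempotent_elt z ->
  clean_elt a -> clean_elt b -> clean_elt (z * a + (1 - z) * b).
Proof.
move=> cz zz [e1 [u1 [ee1 [v1 [uv1 vu1]] ->]]] [e2 [u2 [ee2 [v2 [uv2 vu2]] ->]]].
exists (z * e1 + (1 - z) * e2), (z * u1 + (1 - z) * u2); split.
- by rewrite /idempotent_elt mulr_glue // ee1 ee2.
- exists (z * v1 + (1 - z) * v2).
  by rewrite !mulr_glue // uv1 uv2 vu1 vu2 glue1.
- by rewrite !mulrDr addrACA.
Qed.

(** Here [v] inverts [u] only on the part cut out by [z]; on the other part the filler 1 is
    decomposed as 0 + 1. *)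
Lemma clean_elt_on z e u v : central z -> idempotent_elt z ->
    idempotent_elt e -> z * (u * v) = z -> z * (v * u) = z ->
  clean_elt (z * (e + u) + (1 - z) * 1).
Proof.
move=> cz zz ee uv vu; exists (z * e + (1 - z) * 0), (z * u + (1 - z) * 1); split.
- by rewrite /idempotent_elt mulr_glue // ee mulr0.
- exists (z * v + (1 - z) * 1); rewrite !mulr_glue // uv vu !mulr1.
  by rewrite addrC subrK.
- by rewrite mulr0 addr0 mulrDr addrA.
Qed.

Lemma nilpotent_idem_mul z c n : central z -> idempotent_elt z ->
  z * c ^+ n = 0 -> nilpotent_elt (z * c).
Proof.
(* The exponent exceeds [n] by one because [z ^+ k = z] is available only for positive [k]. *)
move=> cz zz zcn; exists n.+1.
have zX k : z ^+ k.+1 = z by elim: k => // k IHk; rewrite exprS IHk zz.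
by rewrite (exprMn_comm _ (cz c)) zX exprSr mulrA zcn mul0r.
Qed.

(** With [t] the inverse of [s], [a] is the sum of the conjugate [t f s] and the unit
    [t (s a - f s)]. *)
Lemma clean_elt_conj s a f : invertible_elt s -> idempotent_elt f ->
  invertible_elt (s * a - f * s) -> clean_elt a.
Proof.
move=> [t [st ts]] ff uinv; exists (t * f * s), (t * (s * a - f * s)); split.
- by rewrite /idempotent_elt -!mulrA (mulrA s) st mul1r (mulrA f) ff.
- by apply: invertible_eltM => //; exists s.
- by rewrite mulrBr !mulrA ts mul1r addrC subrK.
Qed.

End CleanElements.

Lemma wnc_weakly_clean (R : pzRingType) :
  weakly_nil_clean R -> forall b : R, weakly_clean_elt b.
Proof.
move=> hR b; have [e [q [ee qnil [r eq_r]]]] := hR (- b).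
have eec : e * (1 - e) = 0 by exact: mulr_compl_idem.
have ece : (1 - e) * e = 0 by rewrite mulrBl mul1r ee subrr.
(* The choice of [e], [q], [r] for [- b] gives [(1 - e r) b = - e - q]; with this sign [e] cancels
   when [1 - e] is subtracted, which leaves the unit [- (1 + q)]. *)
exists (1 - e * r), (1 - e); split.
- by rewrite /idempotent_elt {1}mulrBl mul1r eec subr0.
- by rewrite mulrBr mulr1 mulrA ece mul0r subr0.
have -> : (1 - e * r) * b - (1 - e) = - (1 - - q).
  have -> : (1 - e * r) * b = - e - q.
    by rewrite mulrBl mul1r -mulrN -eq_r !addrA subrr add0r.
  by rewrite opprB opprK opprD addrACA addNr add0r addrC.
apply/invertible_eltN/invertible_elt_sub1.
by have [n qn] := qnil; exists n; rewrite exprNn qn mulr0.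
Qed.

(** * Central elements of a weakly nil clean ring *)

Section Center.
Variable R : pzRingType.
Hypothesis hR : weakly_nil_clean R.
Implicit Types c e q r v y z : R.

(* On (1 - e)R the central element c is nilpotent because it acts there as q,
   while e lies in Rc because it is nilpotent modulo c. *)
Lemma central_strongly_pi_regular c : central c ->
  exists n y, c ^+ n = y * c ^+ n.+1.
Proof.
move=> cc; have [e [q [ee [n qn0] [r eq_r]]]] := hR c.
have ece : (1 - e) * e = 0 by rewrite mulrBl mul1r ee subrr.
have fc : (1 - e) * c = (1 - e) * q.
  have /eqP : (1 - e) * (c - e - q) = 0 by rewrite eq_r !mulrA ece !mul0r.
  by rewrite !mulrBr ece subr0 subr_eq0 => /eqP.
have fcX k : (1 - e) * c ^+ k = (1 - e) * q ^+ k.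
  elim: k => [|k IHk]; first by rewrite !expr0.
  have cqk : c * q ^+ k = q ^+ k * c by exact/commrX.
  by rewrite exprSr mulrA IHk -mulrA -cqk mulrA fc -mulrA -exprS.
have e_eq : e = (1 - e * r) * c - q.
  have c_eq : c = e * r * c + (e + q).
    by rewrite -eq_r -[c - e - q]addrA -opprD subrK.
  by rewrite mulrBl mul1r {1}c_eq [_ + (e + q)]addrC !addrK.
(* Multiplying by [e] on the right and replacing the [e] after the power of [- q] by
   [(1 - e r) c - q] raises that power by one. *)
have eX k : exists x, e = x * c + (- q) ^+ k.+1.
  elim: k => [|k [x IHk]]; first by exists (1 - e * r); rewrite expr1.
  exists (x * e + (- q) ^+ k.+1 * (1 - e * r)).
  have qe : (- q) ^+ k.+1 * e = (- q) ^+ k.+1 * (1 - e * r) * c + (- q) ^+ k.+2.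
    by rewrite [X in _ * X = _]e_eq mulrBr mulrA [_ ^+ k.+2]exprSr mulrN.
  by rewrite -[LHS]ee {1}IHk mulrDl -mulrA cc mulrA qe addrA -mulrDl.
have [x] := eX n; rewrite exprS exprNn qn0 !mulr0 addr0 => ex.
exists n, x; rewrite exprS mulrA -ex -[LHS]mul1r -[1 in LHS](subrK e) mulrDl.
by rewrite fcX qn0 mulr0 add0r.
Qed.

(** This is a Fitting decomposition along [c]. Iterating [c ^+ n = y c ^+ n.+1] gives [d = w d d]
    with [d = c ^+ n] and [w = y ^+ n], so [w d] is an idempotent; it cuts out the part where [c] is
    invertible. *)
Lemma central_split c : central c ->
  exists z v n, [/\ central z, idempotent_elt z, z * c ^+ n = 0 & c * v = 1 - z].
Proof.
move=> cc; have [n [y cn]] := central_strongly_pi_regular cc.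
have yX k : c ^+ n = y ^+ k * c ^+ (n + k).
  elim: k => [|k IHk]; first by rewrite expr0 mul1r addn0.
  by rewrite exprSr -mulrA addnS -addSn exprD (mulrA y) -cn -exprD.
have cX k : central (c ^+ k) by move=> x; apply/commr_sym/commrX/commr_sym.
pose d := c ^+ n; have cd : central d by exact: cX.
pose w := y ^+ n; have dw : d = w * d * d by rewrite -mulrA -exprD -yX.
have ww : idempotent_elt (w * d).
  by rewrite /idempotent_elt -mulrA [d * _]cd -dw.
(* Although [y] need not be central, [w d] is: both [w d x] and [x w d] equal [w d x w d]. *)
have cw : central (w * d).
  move=> x; rewrite /GRing.comm.
  have xwd : x * (w * d) = d * (x * w) by rewrite mulrA cd.
  have <- : w * d * x * (w * d) = w * d * x.
    by rewrite -[w * d * x]mulrA cd (mulrA w) -mulrA [d * _]cd -dw.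
  by rewrite -(mulrA (w * d)) xwd mulrA -dw.
exists (1 - w * d), (y * (w * d)), n; split.
- exact: central_compl.
- by rewrite /idempotent_elt mulrBr mulr1 -[_ * (w * d)]cw mulr_compl_idem ?subr0.
- by rewrite mulrBl mul1r -dw subrr.
- rewrite opprB addrC subrK cc -!mulrA -exprSr mulrA -exprS exprSr -mulrA.
  by rewrite -cn.
Qed.

End Center.

(** * Matrix rings and Schur complements *)

Section Matrices.
Variable R : pzRingType.
Hypothesis hR : weakly_nil_clean R.

Lemma invertible_triangular m n (a : 'M[R]_m) (x : 'M_(m, n)) (d : 'M_n) :
  invertible_elt a -> invertible_elt d -> invertible_elt (block_mx a x 0 d).
Proof.
move=> [a' [aa' a'a]] [d' [dd' d'd]]; exists (block_mx a' (- (a' *m x *m d')) 0 d').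
rewrite -!mulmxE in aa' a'a dd' d'd *; rewrite !mulmx_block.
rewrite !mulmx0 !mul0mx !addr0 !add0r aa' a'a dd' d'd mulmxN mulNmx !mulmxA aa'.
by rewrite -!mulmxA d'd mul1mx mulmx1 addNr subrr -scalar_mx_block.
Qed.

(** Block elimination: the matrix is a lower unitriangular one times an upper triangular one with
    diagonal blocks [a] and the Schur complement. *)
Lemma invertible_schur m n (a a' : 'M[R]_m) (x : 'M_(m, n)) y (d : 'M_n) :
    a *m a' = 1%:M -> a' *m a = 1%:M -> invertible_elt (d - y *m a' *m x) ->
  invertible_elt (block_mx a x y d).
Proof.
move=> aa' a'a dinv.
have -> : block_mx a x y d =
    block_mx 1%:M 0 (y *m a') 1%:M * block_mx a x 0 (d - y *m a' *m x).
  rewrite -mulmxE mulmx_block !mul1mx !mul0mx !addr0 -!mulmxA a'a mulmx1.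
  by rewrite addrC subrK.
apply: invertible_eltM; last by apply: invertible_triangular => //; exists a'.
exists (block_mx 1%:M 0 (- (y *m a')) 1%:M); rewrite -!mulmxE !mulmx_block.
rewrite !mulmx0 !mul0mx !mul1mx !mulmx1 !addr0 !add0r.
by rewrite addrN addNr -scalar_mx_block.
Qed.

Lemma weakly_clean_block m n :
    (forall a : 'M[R]_m, weakly_clean_elt a) ->
    (forall d : 'M[R]_n, weakly_clean_elt d) ->
  forall b : 'M[R]_(m + n), weakly_clean_elt b.
Proof.
move=> IHm IHn b; rewrite -[b]submxK.
move: (ulsubmx _) (ursubmx _) (dlsubmx _) (drsubmx _) => a x y d.
have [p [f [ff fp [u' [uu' u'u]]]]] := IHm a.
(* The hypothesis is applied to this corrected block instead of [d], since
   [diag(p, P) b - diag(f, F)] has Schur complement [P (d - y u' p x) - F]. *)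
have [P [F [FF FP Uinv]]] := IHn (d - y *m u' *m (p *m x)).
exists (block_mx p 0 0 P), (block_mx f 0 0 F).
rewrite /idempotent_elt -!mulmxE !mulmx_block.
rewrite !mulmx0 !mul0mx !addr0 !add0r !mulmxE ff fp FF FP.
split=> //; rewrite opp_block_mx add_block_mx !oppr0 !addr0.
apply: invertible_schur uu' u'u _.
by move: Uinv; rewrite -!mulmxE mulmxBr !mulmxA addrAC.
Qed.

Lemma weakly_clean_mx n (b : 'M[R]_n) : weakly_clean_elt b.
Proof.
elim: n b => [|n IHn] b.
  exists 0, 0; split; [exact: mulr0|exact: mulr0|exists 0].
  by split; apply/matrixP => -[].
apply: (@weakly_clean_block 1 n) => // a; rewrite [a]mx11_scalar.
have [p [f [ff fp [u' [uu' u'u]]]]] := wnc_weakly_clean hR (a 0 0).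
exists p%:M, f%:M; rewrite /idempotent_elt -!mulmxE -!scalar_mxM ff fp.
split=> //; exists u'%:M.
by rewrite -raddfB /= -!mulmxE -!scalar_mxM uu' u'u.
Qed.

Lemma central_scalar_mx m c : central c -> central (c%:M : 'M[R]_m).
Proof.
move=> cc A; rewrite /GRing.comm -!mulmxE -!diag_const_mx mul_mx_diag mul_diag_mx.
by apply/matrixP => i j; rewrite !mxE cc.
Qed.

Lemma scalar_mx_mulr m a c : (a * c)%:M = a%:M * c%:M :> 'M[R]_m.
Proof. exact: scalar_mxM. Qed.

Lemma scalar_mx_exp m c k : (c ^+ k)%:M = c%:M ^+ k :> 'M[R]_m.
Proof. by elim: k => // k IHk; rewrite !exprS scalar_mx_mulr IHk. Qed.

(** * Cleanness of diag(b, c) for central c *)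

Section Stabilized.
Variable n : nat.
Implicit Types (c z v w : R) (b x y : 'M[R]_n).

Lemma mulr_block x1 x2 x3 x4 y1 y2 y3 y4 :
  (block_mx x1 x2 x3 x4 : 'M_(n + n)) * block_mx y1 y2 y3 y4 =
  block_mx (x1 * y1 + x2 * y3) (x1 * y2 + x2 * y4)
           (x3 * y1 + x4 * y3) (x3 * y2 + x4 * y4).
Proof. by rewrite -!mulmxE mulmx_block. Qed.

Lemma subr_block x1 x2 x3 x4 y1 y2 y3 y4 :
  (block_mx x1 x2 x3 x4 : 'M_(n + n)) - block_mx y1 y2 y3 y4 =
  block_mx (x1 - y1) (x2 - y2) (x3 - y3) (x4 - y4).
Proof. by rewrite opp_block_mx add_block_mx. Qed.

Lemma block1 : block_mx 1 0 0 1 = 1 :> 'M[R]_(n + n).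
Proof. by rewrite -scalar_mx_block. Qed.

(** The second block has the size of [b], so that 2 x 2 block computations take place over a single
    matrix ring. *)
Definition stabilize b c : 'M[R]_(n + n) := block_mx b 0 0 c%:M.

Lemma clean_stabilize_nilpotent b c :
  central c -> nilpotent_elt c -> clean_elt (stabilize b c).
Proof.
move=> cc cnil; have [p [f [ff fp [u' [uu' u'u]]]]] := weakly_clean_mx b.
pose s : 'M_(n + n) := block_mx p (p - 1) 1 1.
apply: (@clean_elt_conj _ s _ (block_mx f 0 0 1)).
- exists (block_mx 1 (1 - p) (- 1) p); rewrite !mulr_block -block1.
  rewrite !mulr1 !mul1r !mulrN1 !mulN1r !opprB subrr addNr !subrK subrKC.
  by rewrite mulrBr mulrBl mulr1 mul1r !subrKA !subrr.
- by rewrite /idempotent_elt mulr_block !(mulr0, mul0r) !addr0 ff mulr1 add0r.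
(* Since [f p = f], the product [f (p - 1)] vanishes and the difference is [[[p b - f, (p - 1) c],
   [b - 1, c - 1]]]. *)
rewrite mulr_block mulr_block subr_block !(mulr0, mul0r, addr0, add0r).
rewrite mulrBr fp !mulr1 !mul1r subrr subr0.
apply: (@invertible_schur n n _ u') => //.
rewrite !mulmxE; set y := b - 1.
(* The Schur complement is -1 plus a multiple of the central nilpotent [c], hence a unit. *)
have -> : c%:M - 1 - y * u' * ((p - 1) * c%:M) =
    - (1 - c%:M * (1 - y * u' * (p - 1))).
  rewrite mulrBr mulr1 opprB addrAC; congr (_ - _ - _).
  by rewrite !(central_scalar_mx cc) mulrA.
apply/invertible_eltN/invertible_elt_sub1/nilpotent_eltM_central.
  exact: central_scalar_mx.
by have [k ck] := cnil; exists k; rewrite -scalar_mx_exp ck raddf0.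
Qed.

Lemma clean_stabilize_unipotent b c :
  central c -> nilpotent_elt (1 - c) -> clean_elt (stabilize b c).
Proof.
move=> cc cnil; apply: clean_elt_compl.
have -> : 1 - stabilize b c = stabilize (1 - b) (1 - c).
  by rewrite -block1 subr_block !subr0 -raddfB.
by apply: clean_stabilize_nilpotent => //; exact: central_compl.
Qed.

Lemma clean_stabilize_unit b c z v w : central c -> central z -> idempotent_elt z ->
  z * (c * v) = z -> z * ((1 - c) * w) = z ->
  clean_elt (z%:M * stabilize b c + (1 - z%:M) * 1).
Proof.
move=> cc cz zz zcv zcw.
pose C : 'M[R]_n := c%:M; pose x := b - (1 - C).
have cC : central C by exact: central_scalar_mx.
have cZ : central (z%:M : 'M[R]_n) by exact: central_scalar_mx.
have zCv : z%:M * (C * v%:M) = z%:M by rewrite -!scalar_mx_mulr zcv.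
have zCw : z%:M * ((1 - C) * w%:M) = z%:M.
  by rewrite -[1 in LHS]/(1%:M) -raddfB -!scalar_mx_mulr zcw.
(* The first summand is idempotent: it is the column [(1 - C, C)] times the row [(1, 1)], and the
   row times the column is 1. The second is anti-triangular, and [v], [w] invert its antidiagonal
   entries up to sign on the part of [z]. *)
have -> : stabilize b c =
    block_mx (1 - C) (1 - C) C C + block_mx x (- (1 - C)) (- C) 0.
  by rewrite add_block_mx subrKC !subrr addr0.
apply: (@clean_elt_on _ _ _ _ (block_mx 0 (- v%:M) (- w%:M) (- (w%:M * x * v%:M)))).
- exact: central_scalar_mx.
- by rewrite /idempotent_elt -scalar_mx_mulr zz.
- by rewrite /idempotent_elt mulr_block -!mulrDr subrK !mulr1.
- rewrite scalar_mx_block !mulr_block !(mulr0, mul0r, addr0, add0r, mulrNN).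
  rewrite zCv zCw mulrN mulrDr mulrN; congr block_mx.
  by rewrite -(mulrA w%:M) (mulrA (1 - C)) (mulrA z%:M (_ * w%:M)) zCw addNr.
- rewrite scalar_mx_block !mulr_block !(mulr0, mul0r, addr0, add0r, mulrNN).
  rewrite -!cC zCv -(central_compl cC) zCw mulrDr mulNr mulrN; congr block_mx.
  rewrite (mulrA C) cC -(mulrA _ C) (mulrA z%:M _ (C * _)) cZ -(mulrA _ z%:M) zCv.
  by rewrite -cZ addNr.
Qed.

Lemma mul_scalar_stabilize b z c c' : z * c = z * c' ->
  z%:M * stabilize b c = z%:M * stabilize b c'.
Proof.
move=> zc; rewrite scalar_mx_block !mulr_block !(mulr0, mul0r, addr0, add0r).
by rewrite -!scalar_mx_mulr zc.
Qed.

Lemma clean_stabilize b c : central c -> clean_elt (stabilize b c).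
Proof.
move=> cc; have cc1 := central_compl cc.
have [z1 [v1 [n1 [cz1 zz1 zc1 cv1]]]] := central_split hR cc.
have [z2 [v2 [n2 [cz2 zz2 zc2 cv2]]]] := central_split hR cc1.
pose z3 := (1 - z1) * (1 - z2).
have cz3 : central z3 by move=> x; apply/commr_sym/commrM; apply/commr_sym/central_compl.
have cz1c : central (z1 * c) by move=> x; apply/commr_sym/commrM; apply/commr_sym.
have cz2c : central (1 - z2 * (1 - c)).
  by apply: central_compl => x; apply/commr_sym/commrM; apply/commr_sym.
have zz3 : idempotent_elt z3.
  rewrite /idempotent_elt /z3 -mulrA (mulrA (1 - z2)) (central_compl cz2 (1 - z1)).
  by rewrite !mulrA idem_compl // -mulrA idem_compl.
(* As [c] itself need not be nilpotent, it is replaced by [z1 c], which agrees with it on the part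
   of [z1]; [1 - z2 (1 - c)] serves likewise for [z2]. *)
have B1 := clean_stabilize_nilpotent b cz1c (nilpotent_idem_mul cz1 zz1 zc1).
have B2 : clean_elt (stabilize b (1 - z2 * (1 - c))).
  apply: clean_stabilize_unipotent => //.
  by rewrite subKr; exact: (nilpotent_idem_mul cz2 zz2 zc2).
have B3 : clean_elt (z3%:M * stabilize b c + (1 - z3%:M) * 1).
  apply: (@clean_stabilize_unit _ _ _ v1 v2) => //.
    by rewrite cv1 cz3 /z3 mulrA idem_compl.
  by rewrite cv2 /z3 -mulrA idem_compl.
have cZ z : central z -> central (z%:M : 'M[R]_(n + n)) by exact: central_scalar_mx.
have ZZ z : idempotent_elt z -> idempotent_elt (z%:M : 'M[R]_(n + n)).
  by rewrite /idempotent_elt -scalar_mx_mulr => ->.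
have := clean_elt_glue (cZ _ cz1) (ZZ _ zz1) B1
          (clean_elt_glue (cZ _ cz2) (ZZ _ zz2) B2 B3).
congr clean_elt.
have Z3 : (1 - z1%:M) * (1 - z2%:M) = z3%:M :> 'M[R]_(n + n).
  by rewrite scalar_mx_mulr !raddfB.
have -> : z1%:M * stabilize b (z1 * c) = z1%:M * stabilize b c.
  by apply: mul_scalar_stabilize; rewrite mulrA zz1.
have -> : z2%:M * stabilize b (1 - z2 * (1 - c)) = z2%:M * stabilize b c.
  by apply: mul_scalar_stabilize; rewrite mulrBr mulrA zz2 -mulrBr subKr.
(* The filler disappears because [(1 - z1) (1 - z2) = z3] annihilates [1 - z3]. *)
have B_eq : (1 - z1%:M) * ((1 - z2%:M) * (z3%:M * stabilize b c + (1 - z3%:M) * 1)) =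
    (1 - z1%:M) * ((1 - z2%:M) * stabilize b c).
  rewrite mulrA Z3 mulrDr (mulrA z3%:M z3%:M) (ZZ _ zz3) (mulrA z3%:M (1 - _)).
  by rewrite (mulr_compl_idem (ZZ _ zz3)) mul0r addr0 -Z3 mulrA.
rewrite mulrDr B_eq -mulrDr -mulrDl subrKC mul1r -mulrDl.
by rewrite subrKC mul1r.
Qed.

End Stabilized.

(** For the tail of an infinite matrix, the decomposition must stay in the center. The idempotent
    [z] works: [c - z] is [- (1 - z c)] on the part of [z] and [c] on the other. *)
Lemma central_clean (c : R) : central c ->
  exists e u v : R, [/\ central e, central u & central v] /\
    [/\ e * e = e, u * v = 1, v * u = 1 & c = e + u].
Proof.
move=> cc; have [z [v [n [cz zz zcn cv]]]] := central_split hR cc.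
have [w [cw wc]] : invertible_elt (1 - z * c).
  exact/invertible_elt_sub1/(nilpotent_idem_mul cz zz zcn).
have cu : central (c - z) by move=> x; apply/commr_sym/commrB; apply/commr_sym.
have uv : (c - z) * (z * (- w) + (1 - z) * v) = 1.
  have -> : c - z = z * (- (1 - z * c)) + (1 - z) * c.
    by rewrite opprB mulrBr mulr1 mulrA zz mulrBl mul1r [RHS]addrC addrA subrK.
  by rewrite mulr_glue // mulrNN cw cv idem_compl // mulr1 subrKC.
have vu := uv; rewrite cu in vu.
exists z, (c - z), (z * (- w) + (1 - z) * v); split; split=> //.
- exact: (central_inv cu uv vu).
- by rewrite subrKC.
Qed.

End Matrices.

(** * The ring of infinite matrices with a central scalar tail *)

Section AlmostScalarOperators.
Variable R : pzRingType.
Implicit Types c d : R.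

(* The infinite matrix diag(A, c, c, ...) acting on columns. *)
Definition diag_op n (A : 'M[R]_n) c (v : nat -> R) : nat -> R :=
  fun i => if insub i is Some j then \sum_k A j k * v k else c * v i.

Lemma diag_op_ord n (A : 'M[R]_n) c v (i : 'I_n) :
  diag_op A c v i = \sum_k A i k * v k.
Proof. by rewrite /diag_op valK. Qed.

Lemma diag_op_ge n (A : 'M[R]_n) c v i : (n <= i)%N -> diag_op A c v i = c * v i.
Proof. by move=> le_ni; rewrite /diag_op insubF // ltnNge le_ni. Qed.

Lemma eq_op_ord n (u v : nat -> R) : (forall i : 'I_n, u i = v i) ->
  (forall i, (n <= i)%N -> u i = v i) -> u = v.
Proof.
move=> eq_lt eq_ge; apply/funext => i.
by case: (ltnP i n) => [lt_in|]; [exact: (eq_lt (Ordinal lt_in))|exact: eq_ge].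
Qed.

Lemma diag_opM n (A B : 'M[R]_n) c d :
  diag_op A c \o diag_op B d = diag_op (A * B) (c * d).
Proof.
apply/funext => v; apply: (@eq_op_ord n) => [i|i le_ni] /=.
  rewrite !diag_op_ord; under eq_bigr do rewrite diag_op_ord mulr_sumr.
  rewrite exchange_big; apply: eq_bigr => k _; rewrite mxE mulr_suml.
  by apply: eq_bigr => j _; rewrite mulrA.
by rewrite !diag_op_ge // mulrA.
Qed.

Lemma diag_opB n (A B : 'M[R]_n) c d :
  diag_op A c - diag_op B d = diag_op (A - B) (c - d).
Proof.
apply/funext => v; apply: (@eq_op_ord n) => [i|i le_ni] /=.
  rewrite !fctE !diag_op_ord -sumrB; apply: eq_bigr => k _.
  by rewrite !mxE mulrBl.
by rewrite !fctE !diag_op_ge // mulrBl.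
Qed.

Lemma diag_op1 n : diag_op (1 : 'M[R]_n) 1 = id.
Proof.
apply/funext => v; apply: (@eq_op_ord n) => [i|i le_ni] /=.
  rewrite diag_op_ord (bigD1 i) //= big1 => [|k /negPf ki].
    by rewrite mxE eqxx mul1r addr0.
  by rewrite mxE eq_sym ki mul0r.
by rewrite diag_op_ge // mul1r.
Qed.

(** Composition of arbitrary maps distributes over sums on one side only; additivity provides the
    other side. *)
Lemma diag_opD n (A : 'M[R]_n) c u v :
  diag_op A c (u + v) = diag_op A c u + diag_op A c v.
Proof.
apply: (@eq_op_ord n) => [i|i le_ni] /=.
  rewrite !fctE !diag_op_ord -big_split; apply: eq_bigr => k _.
  by rewrite mulrDr.
by rewrite !fctE !diag_op_ge // mulrDr.
Qed.

Lemma diag_op_block n m (A : 'M[R]_n) c :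
  diag_op (block_mx A 0 0 c%:M : 'M_(n + m)) c = diag_op A c.
Proof.
apply/funext => v; apply: (@eq_op_ord (n + m)) => [i|i le_ni] /=.
  rewrite diag_op_ord big_split_ord /=; case: (split_ordP i) => j ->.
    rewrite [RHS](diag_op_ord A c v j) [X in _ + X]big1 ?addr0 => [|k _].
      by apply: eq_bigr => k _; rewrite block_mxEul.
    by rewrite block_mxEur mxE mul0r.
  rewrite [X in X + _]big1 ?add0r => [|k _]; last by rewrite block_mxEdl mxE mul0r.
  rewrite diag_op_ge ?leq_addr // (bigD1 j) //= big1 => [|k /negPf kj].
    by rewrite block_mxEdr mxE eqxx addr0.
  by rewrite block_mxEdr mxE eq_sym kj mul0r.
by rewrite !diag_op_ge // (leq_trans (leq_addr m n)).
Qed.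

Lemma diag_op_widen n N (A : 'M[R]_n) c : (n <= N)%N ->
  exists B : 'M[R]_N, diag_op A c = diag_op B c.
Proof.
move=> /subnKC <-; exists (block_mx A 0 0 c%:M); exact/esym/diag_op_block.
Qed.

(** Operators are used in place of triples [n], [A], [c] so that all paddings of a matrix are equal
    and composition gives the product. *)
Definition almost_scalar : {pred (nat -> R) -> (nat -> R)} :=
  fun phi => `[< exists n (A : 'M[R]_n) c, central c /\ phi = diag_op A c >].

Lemma almost_scalarP phi :
  reflect (exists n (A : 'M[R]_n) c, central c /\ phi = diag_op A c)
          (phi \in almost_scalar).
Proof. exact: asboolP. Qed.

Lemma almost_scalar2 phi psi : phi \in almost_scalar -> psi \in almost_scalar ->
  exists n (A B : 'M[R]_n) c d,
    [/\ central c, central d, phi = diag_op A c & psi = diag_op B d].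
Proof.
move=> /almost_scalarP[n [A [c [cc ->]]]] /almost_scalarP[m [B [d [cd ->]]]].
have [A' ->] := diag_op_widen A c (leq_maxl n m).
have [B' ->] := diag_op_widen B d (leq_maxr n m).
by exists (maxn n m), A', B', c, d.
Qed.

Lemma central1 : central (1 : R).
Proof. by move=> x; apply/commr_sym/commr1. Qed.

Lemma central0 : central (0 : R).
Proof. by move=> x; apply/commr_sym/commr0. Qed.

Lemma id_almost_scalar : id \in almost_scalar.
Proof.
by apply/almost_scalarP; exists 0, 1, 1; rewrite diag_op1; split=> //; apply: central1.
Qed.

Lemma comp_almost_scalar phi psi : phi \in almost_scalar ->
  psi \in almost_scalar -> phi \o psi \in almost_scalar.
Proof.
move=> hphi /(almost_scalar2 hphi)[n [A [B [c [d [cc cd -> ->]]]]]].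
apply/almost_scalarP; exists n, (A * B), (c * d); rewrite diag_opM; split=> //.
by move=> x; apply/commr_sym/commrM; apply/commr_sym.
Qed.

Fact almost_scalar_zmod_closed : zmod_closed almost_scalar.
Proof.
split=> [|phi psi hphi /(almost_scalar2 hphi)[n [A [B [c [d [cc cd -> ->]]]]]]].
  apply/almost_scalarP; exists 0, 0, 0; split; first exact: central0.
  by apply/funext => v; apply/funext => i; rewrite diag_op_ge ?mul0r.
apply/almost_scalarP; exists n, (A - B), (c - d); rewrite diag_opB; split=> //.
by move=> x; apply/commr_sym/commrB; apply/commr_sym.
Qed.

Record scalar_ext := ScalarExt {
  scalar_ext_val : (nat -> R) -> (nat -> R);
  scalar_ext_valP : scalar_ext_val \in almost_scalar
}.

HB.instance Definition _ := [isSub for scalar_ext_val].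
HB.instance Definition _ := [Choice of scalar_ext by <:].
HB.instance Definition _ := GRing.SubChoice_isSubZmodule.Build _ almost_scalar
  scalar_ext almost_scalar_zmod_closed.

Implicit Types x y z : scalar_ext.

Definition scalar_ext_one := ScalarExt id_almost_scalar.

Definition scalar_ext_mul x y :=
  ScalarExt (comp_almost_scalar (scalar_ext_valP x) (scalar_ext_valP y)).

Fact scalar_ext_mulA : associative scalar_ext_mul.
Proof. by move=> x y z; apply/val_inj. Qed.

Fact scalar_ext_mul1r : left_id scalar_ext_one scalar_ext_mul.
Proof. by move=> x; apply/val_inj. Qed.

Fact scalar_ext_mulr1 : right_id scalar_ext_one scalar_ext_mul.
Proof. by move=> x; apply/val_inj. Qed.

Fact scalar_ext_mulDl : left_distributive scalar_ext_mul +%R.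
Proof. by move=> x y z; apply/val_inj. Qed.

Fact scalar_ext_mulDr : right_distributive scalar_ext_mul +%R.
Proof.
move=> [phi hphi] y z; apply/val_inj/funext => v /=.
have /almost_scalarP[n [A [c [_ ->]]]] := hphi; exact: diag_opD.
Qed.

HB.instance Definition _ := GRing.Zmodule_isPzRing.Build scalar_ext
  scalar_ext_mulA scalar_ext_mul1r scalar_ext_mulr1 scalar_ext_mulDl
  scalar_ext_mulDr.

Definition scalar_ext_diag n (A : 'M[R]_n) c (cc : central c) : scalar_ext :=
  ScalarExt (introT (almost_scalarP _)
    (ex_intro _ n (ex_intro _ A (ex_intro _ c (conj cc erefl))))).

End AlmostScalarOperators.

(** * Cleanness of the extension, and [R] as its corner *)

Lemma clean_scalar_ext (R : pzRingType) :
  weakly_nil_clean R -> clean (scalar_ext R).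
Proof.
move=> hR [phi hphi]; have /almost_scalarP[n [b [c [cc phi_eq]]]] := hphi.
(* The finite block, padded to size [n + n], and the tail [c] are decomposed independently. *)
have [E [U [EE [V [UV VU]] EU]]] := clean_stabilize hR b cc.
have [e [u [v [[ce cu cv] [ee uv vu eu]]]]] := central_clean hR cc.
exists (scalar_ext_diag E ce), (scalar_ext_diag U cu); split.
- by apply/val_inj; rewrite /= diag_opM EE ee.
- exists (scalar_ext_diag V cv).
  by split; apply/val_inj; rewrite /= diag_opM ?UV ?VU ?uv ?vu diag_op1.
apply/eqP; rewrite addrC -subr_eq; apply/eqP/val_inj; rewrite /= phi_eq.
rewrite -(diag_op_block n) diag_opB -/(stabilize b c) EU eu.
by rewrite ![_ + _ - _]addrAC !subrr !add0r.
Qed.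

Theorem corollary3p21 (R : pzRingType) (hR : weakly_nil_clean R) :
  exists (S : pzRingType) (e : S) (idem_e : idempotent_elt e),
    clean S /\ exists phi : {rmorphism R -> corner idem_e}, bijective phi.
Proof.
pose iota (r : R) : scalar_ext R := scalar_ext_diag (r%:M : 'M_1) (@central0 R).
have iotaB : {morph iota : x y / x - y}.
  by move=> x y; apply/val_inj; rewrite /= diag_opB subrr -raddfB.
have iotaM : {morph iota : x y / x * y}.
  by move=> x y; apply/val_inj; rewrite /= diag_opM mulr0 -scalar_mx_mulr.
have idem_e : idempotent_elt (iota 1) by rewrite /idempotent_elt -iotaM mulr1.
exists (scalar_ext R), (iota 1), idem_e; split; first exact: clean_scalar_ext.
have iotaP r : iota r \in in_corner (iota 1).
  by rewrite inE -!iotaM mulr1 mul1r.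
pose phi r : corner idem_e := Corner idem_e (iotaP r).
have phiB : zmod_morphism phi by move=> x y; apply/val_inj; rewrite /= iotaB.
have phiM : monoid_morphism phi.
  by split=> [|x y]; apply/val_inj => //=; rewrite iotaM.
pose phiA := GRing.isZmodMorphism.Build _ _ phi phiB.
pose phiR := GRing.isMonoidMorphism.Build _ _ phi phiM.
pose phi_rmorph : {rmorphism R -> corner idem_e} := HB.pack phi phiA phiR.
exists phi_rmorph.
have iota_val r v : val (iota r) v 0 = r * v 0.
  by rewrite /= (diag_op_ord _ _ _ (0 : 'I_1)) big_ord1 mxE mulr1n.
(* Applying [iota r] to the constant column 1 gives [r] at coordinate 0. *)
pose g (x : corner idem_e) := scalar_ext_val (corner_val x) (fun=> 1) 0.
have phiK : cancel phi g by move=> r; apply: etrans (iota_val r _) (mulr1 r).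
suff phi_surj x : exists r, x = phi r.
  by exists g => // x; have [r ->] := phi_surj x; rewrite phiK.
have /(in_cornerP idem_e)[[psi hpsi] x_eq] := corner_valP x.
have /almost_scalarP[n [A0 [c [_ psi_eq0]]]] := hpsi.
(* As [n] may be 0, the size becomes [1 + n] to have a first diagonal entry. *)
have [A psi_eq] := diag_op_widen A0 c (leq_addl 1 n).
exists (ulsubmx (A : 'M_(1 + n)) 0 0); apply/val_inj; apply: (etrans x_eq).
apply/val_inj; rewrite /= psi_eq0 psi_eq -!(@diag_op_block R 1 n).
rewrite [LHS](_ : _ = diag_op ((block_mx 1%:M 0 0 0%:M : 'M_(1 + n)) * A *
   (block_mx 1%:M 0 0 0%:M : 'M_(1 + n))) (0 * c * 0)); last by rewrite -!diag_opM.
rewrite mulr0; congr diag_op; rewrite -{1}[A](@submxK _ 1 n 1 n) -!mulmxE.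
rewrite !mulmx_block (raddf0 (@scalar_mx R n)).
by rewrite !(mulmx0, mul0mx, addr0, mul1mx, mulmx1) -mx11_scalar.
Qed.
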